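(* For the relay Markov decision process $\{(Y_n,A_n),n\ge0\}$ described in the context, the optimal policy (minimizing the long-run average cost $V(u)=\lim_{N\to\infty}\frac{1}{N+1}E_u[\sum_{n=0}^N C(Y_n,A_n)\mid Y_0=(0,0)]$) is of threshold type: there exist nonnegative integers $L_1^*,L_2^*$ such that the optimal deterministic action in state $(i,0)$ is to wait ($A_n=0$) if $i\le L_1^*$ and to transmit without coding ($A_n=1$) if $i>L_1^*$, while in state $(0,j)$ it is to wait if $j\le L_2^*$ and to transmit without coding if $j>L_2^*$.
   Context: A relay node keeps two queues $q_1,q_2$. Time is slotted; in each slot a packet arrives to $q_i$ with probability $p_i\in(0,1)$ ($i=1,2$), independently across queues and slots, at most one per queue per slot. $Y_n=(Y_n^1,Y_n^2)$ is the number of packets in $(q_1,q_2)$ at the end of slot $n$ just before the transmission opportunity, and $A_n\in\{0,1\}$ is the action ($0$ = do nothing, $1$ = transmit). If $Y^1_n+Y^2_n=0$ then $A_n=0$; if $Y^1_nY^2_n>0$ then $A_n=1$ (XOR-coded transmission of one packet from each queue). The state space is $\{(i,j)\in\mathbb{Z}_{\ge0}^2:\min(i,j)\le1\}$. With $\hat p_1=(1-p_1)(1-p_2)$, $\hat p_2=p_1(1-p_2)$, $\hat p_3=(1-p_1)p_2$, $\hat p_4=p_1p_2$, $[x]^+=\max(x,0)$: $P_1((i,j),([i-1]^+,[j-1]^+))=\hat p_1$, $P_1((i,j),(\max(i,1),[j-1]^+))=\hat p_2$, $P_1((i,j),([i-1]^+,\max(j,1)))=\hat p_3$, $P_1((i,j),(\max(i,1),\max(j,1)))=\hat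 p_4$, $P_0((i,j),(i,j))=\hat p_1$, $P_0((i,j),(i+1,j))=\hat p_2$, $P_0((i,j),(i,j+1))=\hat p_3$, $P_0((i,j),(i+1,j+1))=\hat p_4$. One-step cost: $C(Y_n,A_n)=C_h([Y^1_n-A_n]^+ + [Y^2_n-A_n]^+)+C_tA_n$, where $C_t>0$ is the transmission cost and $C_h>0$ the per-slot holding cost. *)

(* Defs.v *)
From Stdlib Require Import Reals List Arith.
From Coquelicot Require Import Coquelicot.
Import ListNotations.
Open Scope R_scope.

(* A state (i,j) = numbers of packets in (q1,q2). *)
Definition state := (nat * nat)%type.

(* Actions: false = 0 (do nothing), true = 1 (transmit). *)
Definition act_nat (a : bool) : nat := if a then 1%nat else 0%nat.

(* Transition kernel P_a(y, .) as a list of (probability, next state).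
   Natural-number subtraction [i - 1] is truncated, i.e. [i-1]^+. *)
Definition trans (p1 p2 : R) (y : state) (a : bool) : list (R * state) :=
  let (i, j) := y in
  let ph1 := (1 - p1) * (1 - p2) in
  let ph2 := p1 * (1 - p2) in
  let ph3 := (1 - p1) * p2 in
  let ph4 := p1 * p2 in
  if a then
    [ (ph1, (i - 1, j - 1)%nat); (ph2, (Nat.max i 1, j - 1)%nat);
      (ph3, (i - 1, Nat.max j 1)%nat); (ph4, (Nat.max i 1, Nat.max j 1)) ]
  else
    [ (ph1, (i, j)); (ph2, (S i, j)); (ph3, (i, S j)); (ph4, (S i, S j)) ].

Definition cost (Ch Ct : R) (y : state) (a : bool) : R :=
  Ch * INR ((fst y - act_nat a) + (snd y - act_nat a))%nat + Ct * INR (act_nat a).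

(* A (general, history-dependent, randomized) policy: given the past
   history of (state, action) pairs and the current state, the
   probability of transmitting (A_n = 1). *)
Definition history := list (state * bool).
Definition policy := history -> state -> R.

Definition admissible (pol : policy) : Prop :=
  forall (h : history) (y : state),
    0 <= pol h y <= 1 /\
    ((fst y + snd y = 0)%nat -> pol h y = 0) /\
    ((0 < fst y * snd y)%nat -> pol h y = 1).

Fixpoint exp_cost (p1 p2 Ch Ct : R) (pol : policy) (N : nat)
         (h : history) (y : state) {struct N} : R :=
  let q := pol h y in
  let cont (a : bool) : R :=
    match N with
    | O => 0
    | S N' => fold_right
                (fun e acc => fst e * exp_cost p1 p2 Ch Ct pol N' (h ++ [(y, a)]) (snd e) + acc)
                0 (trans p1 p2 y a)
    end in
  q * (cost Ch Ct y true + cont true) + (1 - q) * (cost Ch Ct y false + cont false).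

Definition avg_cost (p1 p2 Ch Ct : R) (pol : policy) : Rbar :=
  LimSup_seq (fun N => exp_cost p1 p2 Ch Ct pol N [] (0%nat, 0%nat) / INR (S N)).

Definition threshold_policy (L1 L2 : nat) : policy :=
  fun _ y =>
    if Nat.ltb 0 (fst y * snd y) then 1
    else if Nat.eqb (snd y) 0 then (if Nat.ltb L1 (fst y) then 1 else 0)
    else (if Nat.ltb L2 (snd y) then 1 else 0).

(* Main.v *)
(** After each decision at most one queue is nonempty, so the post-decision
    state is an integer [x].  Let [f x] be the marginal value of the [x]-th packet
    of [q1] for [x >= 1], and [Ct] minus the marginal value of the [(1-x)]-th
    packet of [q2] for [x <= 0].  Since a packet is worth at most its transmission
    cost, the average-cost optimality equation becomes the equation of a Dynkin
    game: [f] is the average of its neighbours plus or minus a multiple of [Ch],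
    clamped to [[0, Ct]].  Monotone iteration yields a nondecreasing solution,
    which gains a fixed amount at each step until it hits [0] and [Ct]; the hitting
    points are the thresholds.  Summing [f] gives a potential whose drift is at
    least the constant [g] everywhere, with equality along the threshold policy. *)

Require Import Defs.
From Stdlib Require Import Reals List Arith.
From Coquelicot Require Import Coquelicot.
From Stdlib Require Import ZArith Lra Lia Wf_nat.
Open Scope R_scope.

(** * Clamping to an interval *)

Definition clamp (C z : R) : R := Rmax 0 (Rmin C z).

Lemma clamp_bounds (C z : R) : 0 <= C -> 0 <= clamp C z <= C.
Proof.
  intros HC; unfold clamp, Rmax, Rmin.
  destruct (Rle_dec C z); destruct (Rle_dec 0 _); lra.
Qed.

Lemma clamp_le (C z t : R) : z <= t -> clamp C z <= clamp C t.
Proof.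
  intros Hzt; unfold clamp; apply Rmax_case_strong; intros _.
  - apply Rmax_l.
  - eapply Rle_trans; [|apply Rmax_r]; apply Rle_min_compat_l; exact Hzt.
Qed.

Lemma is_lim_seq_clamp (C l : R) (u : nat -> R) :
  is_lim_seq u l -> is_lim_seq (fun n => clamp C (u n)) (clamp C l).
Proof.
  intros Hu.
  apply (is_lim_seq_continuous (clamp C) u l); [|exact Hu].
  (* [clamp C] is 1-Lipschitz, so [eps] itself serves as the modulus of continuity. *)
  intros eps Heps; exists eps; split; [exact Heps|]; intros x [_ Hx].
  simpl in *; unfold Rdist in *; revert Hx.
  unfold clamp, Rmax, Rmin, Rabs; repeat destruct Rcase_abs;
    repeat destruct Rle_dec; lra.
Qed.

(** * A Dynkin game on the integers and its monotone fixed point *)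

Definition side (y : Z) : R := if Z.leb 1 y then 1 else -1.

(* The Bellman operator of a Dynkin game on the integers: the walk steps right
   with probability [a], the running reward is [c * side], and the players may
   stop at the payoffs [0] and [C]. *)
Definition dynkin (C a c : R) (f : Z -> R) (y : Z) : R :=
  clamp C (a * f (y + 1)%Z + (1 - a) * f (y - 1)%Z + c * side y).

Fixpoint dynkin_iter (C a c : R) (n : nat) : Z -> R :=
  match n with
  | O => fun _ => 0
  | S m => dynkin C a c (dynkin_iter C a c m)
  end.

Lemma side_le (y z : Z) : (y <= z)%Z -> side y <= side z.
Proof.
  intros H; unfold side; destruct (Z.leb_spec 1 y), (Z.leb_spec 1 z);
    lra || lia.
Qed.

Lemma dynkin_le (C a c : R) (f h : Z -> R) :
  0 <= a <= 1 -> (forall y, f y <= h y) ->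
  forall y, dynkin C a c f y <= dynkin C a c h y.
Proof.
  intros Ha Hfh y; apply clamp_le.
  assert (H1 := Hfh (y + 1)%Z); assert (H2 := Hfh (y - 1)%Z); nra.
Qed.

Lemma dynkin_iter_bounds (C a c : R) (n : nat) (y : Z) :
  0 <= C -> 0 <= dynkin_iter C a c n y <= C.
Proof.
  intros HC; destruct n as [|n]; simpl; [lra|].
  apply clamp_bounds; exact HC.
Qed.

Lemma dynkin_iter_incr (C a c : R) (n : nat) :
  0 <= C -> 0 <= a <= 1 ->
  forall y, dynkin_iter C a c n y <= dynkin_iter C a c (S n) y.
Proof.
  intros HC Ha; induction n as [|n IH]; intros y.
  - apply (dynkin_iter_bounds C a c 1 y HC).
  - apply dynkin_le; assumption.
Qed.

(** The reward [c * side] is nondecreasing, and averaging over neighbours and clamping both preserve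
    monotonicity in the position. *)
Lemma dynkin_iter_mono (C a c : R) (n : nat) :
  0 <= a <= 1 -> 0 <= c ->
  forall y z, (y <= z)%Z -> dynkin_iter C a c n y <= dynkin_iter C a c n z.
Proof.
  intros Ha Hc; induction n as [|n IH]; intros y z Hyz; simpl; [lra|].
  apply clamp_le.
  assert (H1 := IH (y + 1)%Z (z + 1)%Z ltac:(lia)).
  assert (H2 := IH (y - 1)%Z (z - 1)%Z ltac:(lia)).
  assert (H3 := side_le y z Hyz); nra.
Qed.

(** Started from [0], the iterates increase and stay below [C], so they converge pointwise; order
    relations survive the limit, and continuity of [clamp] makes the limit a fixed point. *)
Lemma dynkin_fixpoint (C a c : R) :
  0 <= C -> 0 <= a <= 1 -> 0 <= c ->
  exists f : Z -> R,
    (forall y, 0 <= f y <= C) /\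
    (forall y z, (y <= z)%Z -> f y <= f z) /\
    (forall y, f y = dynkin C a c f y).
Proof.
  intros HC Ha Hc.
  set (u := dynkin_iter C a c).
  assert (Hlim : forall y, is_lim_seq (fun n => u n y)
                             (real (Lim_seq (fun n => u n y)))).
  { intros y; apply Lim_seq_correct'.
    apply ex_finite_lim_seq_incr with C; intros n.
    - apply dynkin_iter_incr; assumption.
    - apply dynkin_iter_bounds; assumption. }
  exists (fun y => real (Lim_seq (fun n => u n y))).
  split; [|split].
  - intros y; split.
    + apply (is_lim_seq_le (fun _ => 0) (fun n => u n y) 0
               (real (Lim_seq (fun n => u n y)))); auto using is_lim_seq_const.
      intros n; apply dynkin_iter_bounds; exact HC.
    + apply (is_lim_seq_le (fun n => u n y) (fun _ => C)
               (real (Lim_seq (fun n => u n y))) C); auto using is_lim_seq_const.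
      intros n; apply dynkin_iter_bounds; exact HC.
  - intros y z Hyz.
    apply (is_lim_seq_le (fun n => u n y) (fun n => u n z)
             (real (Lim_seq (fun n => u n y)))
             (real (Lim_seq (fun n => u n z)))); auto.
    intros n; apply dynkin_iter_mono; assumption.
  - intros y.
    assert (H1 := proj1 (is_lim_seq_incr_1 _ _) (Hlim y)).
    assert (H2 : is_lim_seq (fun n => u (S n) y)
              (dynkin C a c (fun z => real (Lim_seq (fun n => u n z))) y)).
    { apply is_lim_seq_clamp.
      apply is_lim_seq_plus'; [|apply is_lim_seq_const].
      apply is_lim_seq_plus';
        apply (is_lim_seq_scal_l _ _ (Finite _)); apply Hlim. }
    apply is_lim_seq_unique in H1; apply is_lim_seq_unique in H2.
    rewrite H1 in H2; injection H2; auto.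
Qed.

(** To the right of [0] an average of nonnegative values plus [c] is positive, so only the cap [C]
    can bind. Symmetrically, [dynkin_left] keeps only the floor [0]. *)
Lemma dynkin_right (C a c : R) (f : Z -> R) (y : Z) :
  0 <= a <= 1 -> 0 < c -> (forall z, 0 <= f z <= C) ->
  f y = dynkin C a c f y -> (1 <= y)%Z ->
  f y = Rmin C (a * f (y + 1)%Z + (1 - a) * f (y - 1)%Z + c).
Proof.
  intros Ha Hc Hf Hfix Hy; rewrite Hfix; unfold dynkin, clamp, side.
  destruct (Z.leb_spec 1 y); [|lia].
  assert (H1 := Hf (y + 1)%Z); assert (H2 := Hf (y - 1)%Z).
  rewrite Rmult_1_r; apply Rmax_right, Rmin_glb; [lra|nra].
Qed.

Lemma dynkin_left (C a c : R) (f : Z -> R) (y : Z) :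
  0 <= a <= 1 -> 0 < c -> (forall z, 0 <= f z <= C) ->
  f y = dynkin C a c f y -> (y <= 0)%Z ->
  f y = Rmax 0 (a * f (y + 1)%Z + (1 - a) * f (y - 1)%Z - c).
Proof.
  intros Ha Hc Hf Hfix Hy; rewrite Hfix; unfold dynkin, clamp, side.
  destruct (Z.leb_spec 1 y); [lia|].
  assert (H1 := Hf (y + 1)%Z); assert (H2 := Hf (y - 1)%Z).
  rewrite Rmin_right by nra.
  f_equal; ring.
Qed.

(** * Hitting points and the verification certificate *)

Lemma least_true (P : nat -> Prop) :
  (forall n, P n \/ ~ P n) -> (exists n, P n) ->
  exists n, P n /\ forall m, (m < n)%nat -> ~ P m.
Proof.
  intros Hdec Hex.
  destruct (dec_inh_nat_subset_has_unique_least_element P Hdec Hex)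
    as [n [[Hn Hmin] _]].
  exists n; split; [exact Hn|]; intros m Hm HPm.
  specialize (Hmin m HPm); lia.
Qed.

Lemma reaches_cap (C c : R) (u : nat -> R) :
  0 < c -> 0 <= u O -> (forall n, u n <= C) ->
  (forall n, u (S n) = C \/ u n + c <= u (S n)) ->
  exists n, u (S n) = C.
Proof.
  intros Hc H0 HC Hstep.
  destruct (INR_unbounded (C / c)) as [N HN].
  assert (HN' : C < INR N * c).
  { apply (Rmult_lt_compat_r c) in HN; [|exact Hc].
    unfold Rdiv in HN; rewrite Rmult_assoc, Rinv_l in HN; lra. }
  assert (H : forall n, (exists m, u (S m) = C) \/ INR n * c <= u n).
  { induction n as [|n [IH|IH]]; [right; simpl; lra|left; exact IH|].
    destruct (Hstep n) as [H|H]; [left; exists n; exact H|right].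
    rewrite S_INR; lra. }
  destruct (H N) as [H'|H']; [exact H'|].
  specialize (HC N); lra.
Qed.

(* The one-step drift at the post-decision state [x] (the contents of [q1] if
   [0 <= x], minus those of [q2] otherwise) of the potential with increments
   [f x] on the positive side and [f x - Ct] on the other. *)
Definition drift (p1 p2 Ch Ct : R) (f : Z -> R) (x : Z) : R :=
  Ch * IZR (Z.abs x) + p1 * (1 - p2) * f (x + 1)%Z
  + (1 - p1) * p2 * (Ct - f x) + p1 * p2 * Ct.

(** Data for a verification argument: [g] is the optimal average cost, and [[-L2, L1]] is the range
    of post-decision states under the threshold policy. At the two hitting points the next packet is
    worth exactly [Ct], so sending it costs nothing extra. *)
Record certificate (p1 p2 Ch Ct : R) (f : Z -> R) (g : R) (L1 L2 : nat) : Prop :=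
  Certificate {
    cert_bounds : forall x, 0 <= f x <= Ct;
    cert_right : f (Z.of_nat L1 + 1)%Z = Ct;
    cert_left : f (- Z.of_nat L2)%Z = 0;
    cert_drift : forall x, g <= drift p1 p2 Ch Ct f x;
    cert_drift_eq : forall x, (- Z.of_nat L2 <= x <= Z.of_nat L1)%Z ->
      drift p1 p2 Ch Ct f x = g
  }.

Lemma certificate_exists (p1 p2 Ch Ct : R) :
  0 < p1 < 1 -> 0 < p2 < 1 -> 0 < Ct -> 0 < Ch ->
  exists f g L1 L2, certificate p1 p2 Ch Ct f g L1 L2.
Proof.
  intros Hp1 Hp2 HCt HCh.
  (* [s] is the probability that exactly one queue receives a packet, and [a] below is the
     conditional probability that it is [q1]. Dividing by [s] turns differences of the drift into
     the equation of the game. *)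
  set (s := p1 * (1 - p2) + (1 - p1) * p2).
  assert (Hs2 : 0 < p1 * (1 - p2)) by (apply Rmult_lt_0_compat; lra).
  assert (Hs3 : 0 < (1 - p1) * p2) by (apply Rmult_lt_0_compat; lra).
  assert (Hs : 0 < s) by (unfold s; lra).
  set (a := p1 * (1 - p2) / s); set (c := Ch / s).
  assert (Hsa : s * a = p1 * (1 - p2)) by (unfold a; field; lra).
  assert (Hsc : s * c = Ch) by (unfold c; field; lra).
  assert (Ha : 0 <= a <= 1).
  { split; apply Rmult_le_reg_l with s; try lra; rewrite Hsa; unfold s; lra. }
  assert (Hc : 0 < c) by (apply Rdiv_lt_0_compat; lra).
  destruct (dynkin_fixpoint Ct a c) as [f [Hf [Hmono Hfix]]]; try lra.
  assert (Hr := fun y => dynkin_right Ct a c f y Ha Hc Hf (Hfix y)).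
  assert (Hl := fun y => dynkin_left Ct a c f y Ha Hc Hf (Hfix y)).
  destruct (least_true (fun n => f (Z.of_nat n + 1)%Z = Ct)) as [L1 [HL1 HL1']].
  { intros n; destruct (Req_dec (f (Z.of_nat n + 1)%Z) Ct); auto. }
  { destruct (reaches_cap Ct c (fun n => f (Z.of_nat n))) as [n Hn]; auto;
      try (intros; apply Hf).
    - intros n; replace (Z.of_nat (S n)) with (Z.of_nat n + 1)%Z by lia.
      rewrite (Hr (Z.of_nat n + 1)%Z) by lia.
      (* By monotonicity the average of the two neighbours of [n + 1] is at least [f n], so an
         uncapped step gains at least [c]. *)
      assert (H1 := Hmono (Z.of_nat n) (Z.of_nat n + 1 + 1)%Z ltac:(lia)).
      replace (Z.of_nat n + 1 - 1)%Z with (Z.of_nat n) by lia.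
      apply Rmin_case; [left; reflexivity|right; nra].
    - exists n; rewrite <- Hn; f_equal; lia. }
  destruct (least_true (fun n => f (- Z.of_nat n)%Z = 0)) as [L2 [HL2 HL2']].
  { intros n; destruct (Req_dec (f (- Z.of_nat n)%Z) 0); auto. }
  (* The reflection turns descent to [0] on the left into ascent to the cap; its term of index [S n]
     involves [f (- n)]. *)
  { destruct (reaches_cap Ct c (fun n => Ct - f (1 - Z.of_nat n)%Z)) as [n Hn];
      auto.
    - specialize (Hf (1 - Z.of_nat 0)%Z); lra.
    - intros n; specialize (Hf (1 - Z.of_nat n)%Z); lra.
    - intros n; replace (1 - Z.of_nat (S n))%Z with (- Z.of_nat n)%Z by lia.
      rewrite (Hl (- Z.of_nat n)%Z) by lia.
      assert (H1 := Hmono (- Z.of_nat n - 1)%Z (1 - Z.of_nat n)%Z ltac:(lia)).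
      replace (- Z.of_nat n + 1)%Z with (1 - Z.of_nat n)%Z by lia.
      apply Rmax_case; [left; lra|right; nra].
    - exists n; replace (- Z.of_nat n)%Z with (1 - Z.of_nat (S n))%Z by lia.
      lra. }
  set (G := drift p1 p2 Ch Ct f).
  (* Increments of the drift away from the origin are [s] times the gap between [f y] and its
     unclamped value. *)
  assert (HGr : forall y, (1 <= y)%Z -> G y - G (y - 1)%Z =
            s * (a * f (y + 1)%Z + (1 - a) * f (y - 1)%Z + c - f y)).
  { intros y Hy; unfold G, drift.
    replace (Z.abs (y - 1)) with (Z.abs y - 1)%Z by lia.
    replace (y - 1 + 1)%Z with y by lia.
    rewrite minus_IZR.
    transitivity (s * a * f (y + 1)%Z + (s - s * a) * f (y - 1)%Z + s * c - s * f y);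
      [rewrite Hsa, Hsc; unfold s|]; ring. }
  assert (HGl : forall y, (y <= 0)%Z -> G (y - 1)%Z - G y =
            s * (f y - (a * f (y + 1)%Z + (1 - a) * f (y - 1)%Z - c))).
  { intros y Hy; unfold G, drift.
    replace (Z.abs (y - 1)) with (Z.abs y + 1)%Z by lia.
    replace (y - 1 + 1)%Z with y by lia.
    rewrite plus_IZR.
    transitivity (s * f y - (s * a * f (y + 1)%Z + (s - s * a) * f (y - 1)%Z - s * c));
      [rewrite Hsa, Hsc; unfold s|]; ring. }
  exists f, (G 0%Z), L1, L2; split; auto.
  (* Clamping lowers [f] on the right and raises it on the left, so by [HGr] and [HGl] the drift can
     only grow away from the origin. *)
  - assert (Hright : forall n, G 0%Z <= G (Z.of_nat n)).
    { induction n as [|n IH]; [apply Rle_refl|].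
      assert (H := HGr (Z.of_nat (S n)) ltac:(lia)).
      assert (H' := Hr (Z.of_nat (S n)) ltac:(lia)).
      assert (H2 := Rmin_r Ct (a * f (Z.of_nat (S n) + 1)%Z +
                               (1 - a) * f (Z.of_nat (S n) - 1)%Z + c)).
      rewrite <- H' in H2.
      replace (Z.of_nat (S n) - 1)%Z with (Z.of_nat n) in * by lia.
      nra. }
    assert (Hleft : forall n, G 0%Z <= G (- Z.of_nat n)%Z).
    { induction n as [|n IH]; [apply Rle_refl|].
      assert (H := HGl (- Z.of_nat n)%Z ltac:(lia)).
      assert (H' := Hl (- Z.of_nat n)%Z ltac:(lia)).
      assert (H2 := Rmax_r 0 (a * f (- Z.of_nat n + 1)%Z +
                               (1 - a) * f (- Z.of_nat n - 1)%Z - c)).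
      rewrite <- H' in H2.
      replace (- Z.of_nat (S n))%Z with (- Z.of_nat n - 1)%Z by lia.
      nra. }
    intros x; destruct (Z.le_ge_cases 0 x).
    + rewrite <- (Z2Nat.id x) by lia; apply Hright.
    + replace x with (- Z.of_nat (Z.to_nat (- x)))%Z by lia; apply Hleft.
  (* By minimality of [L1] and [L2] the clamp is inactive strictly before the hitting points, so
     these increments vanish. *)
  - assert (Hright : forall n, (n <= L1)%nat -> G (Z.of_nat n) = G 0%Z).
    { induction n as [|n IH]; [reflexivity|]; intros Hn.
      assert (H := HGr (Z.of_nat (S n)) ltac:(lia)).
      assert (H' := Hr (Z.of_nat (S n)) ltac:(lia)).
      assert (Hlt : f (Z.of_nat (S n)) <> Ct).
      { replace (Z.of_nat (S n)) with (Z.of_nat n + 1)%Z by lia.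
        apply HL1'; lia. }
      unfold Rmin in H'; destruct Rle_dec as [|] in H'; [contradiction|].
      replace (Z.of_nat (S n) - 1)%Z with (Z.of_nat n) in * by lia.
      rewrite <- H', Rminus_diag, Rmult_0_r in H.
      rewrite <- IH by lia; lra. }
    assert (Hleft : forall n, (n <= L2)%nat -> G (- Z.of_nat n)%Z = G 0%Z).
    { induction n as [|n IH]; [reflexivity|]; intros Hn.
      assert (H := HGl (- Z.of_nat n)%Z ltac:(lia)).
      assert (H' := Hl (- Z.of_nat n)%Z ltac:(lia)).
      assert (Hlt : f (- Z.of_nat n)%Z <> 0) by (apply HL2'; lia).
      unfold Rmax in H'; destruct Rle_dec as [|] in H'; [|contradiction].
      replace (- Z.of_nat (S n))%Z with (- Z.of_nat n - 1)%Z by lia.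
      rewrite <- H', Rminus_diag, Rmult_0_r in H.
      rewrite <- IH by lia; lra. }
    intros x Hx; destruct (Z.le_ge_cases 0 x).
    + rewrite <- (Z2Nat.id x) by lia; apply Hright; lia.
    + replace x with (- Z.of_nat (Z.to_nat (- x)))%Z by lia; apply Hleft; lia.
Qed.

(** The outer values are [0] on the right but [Ct] on the left, because the increments of the
    potential there are [f] and [Ct - f] respectively. *)
Definition truncate (Ct : R) (K : nat) (f : Z -> R) (x : Z) : R :=
  if Z.leb x (Z.of_nat K) then
    if Z.leb (- Z.of_nat K) x then f x else Ct
  else 0.

(* Far from the origin the holding cost alone exceeds [g], so the increments of
   the potential may be dropped there, which makes the potential bounded. *)
Lemma certificate_truncate (p1 p2 Ch Ct : R) (f : Z -> R) (g : R) (L1 L2 : nat) :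
  0 < p1 < 1 -> 0 < p2 < 1 -> 0 < Ct -> 0 < Ch ->
  certificate p1 p2 Ch Ct f g L1 L2 ->
  exists K, certificate p1 p2 Ch Ct (truncate Ct K f) g L1 L2.
Proof.
  intros Hp1 Hp2 HCt HCh [Hf H1 H2 HG HGeq].
  destruct (INR_unbounded (g / Ch)) as [M HM].
  (* [M] makes the holding cost at distance [K] exceed [g]; the other terms keep the hitting points,
     and the site [x + 1] read by the drift at [x <= L1], inside the untouched range. *)
  set (K := (M + L1 + L2 + 1)%nat); exists K.
  assert (Hb : forall x, 0 <= truncate Ct K f x <= Ct).
  { intros x; unfold truncate.
    destruct (Z.leb x _); [destruct (Z.leb _ x)|]; try lra; apply Hf. }
  assert (Hin : forall x, (- Z.of_nat K <= x <= Z.of_nat K)%Z ->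
                          truncate Ct K f x = f x).
  { intros x Hx; unfold truncate.
    destruct (Z.leb_spec x (Z.of_nat K)); [|lia].
    destruct (Z.leb_spec (- Z.of_nat K) x); [reflexivity|lia]. }
  assert (Hd : forall x, (- Z.of_nat K <= x < Z.of_nat K)%Z ->
     drift p1 p2 Ch Ct (truncate Ct K f) x = drift p1 p2 Ch Ct f x).
  { intros x Hx; unfold drift; rewrite !Hin by lia; reflexivity. }
  split; auto.
  - rewrite Hin by lia; exact H1.
  - rewrite Hin by lia; exact H2.
  - intros x.
    destruct (Z_lt_dec (Z.abs x) (Z.of_nat K)) as [Hx|Hx].
    + rewrite Hd by lia; apply HG.
    + unfold drift.
      assert (Habs : INR M <= IZR (Z.abs x)) by (rewrite INR_IZR_INZ; apply IZR_le; lia).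
      assert (Hg : g <= Ch * IZR (Z.abs x)).
      { replace g with (Ch * (g / Ch)) by (field; lra).
        apply Rmult_le_compat_l; lra. }
      assert (Hx0 := Hb x); assert (Hx1 := Hb (x + 1)%Z).
      assert (0 <= p1 * (1 - p2) * truncate Ct K f (x + 1)%Z)
        by (repeat apply Rmult_le_pos; lra).
      assert (0 <= (1 - p1) * p2 * (Ct - truncate Ct K f x))
        by (repeat apply Rmult_le_pos; lra).
      assert (0 <= p1 * p2 * Ct) by (repeat apply Rmult_le_pos; lra).
      lra.
  - intros x Hx; rewrite Hd by lia; apply HGeq; exact Hx.
Qed.

(** * The potential and its one-step drift *)

Fixpoint pot1 (f : Z -> R) (n : nat) : R :=
  match n with
  | O => 0
  | S m => pot1 f m + f (Z.of_nat m + 1)%Z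
  end.

Fixpoint pot2 (Ct : R) (f : Z -> R) (n : nat) : R :=
  match n with
  | O => 0
  | S m => pot2 Ct f m + (Ct - f (- Z.of_nat m)%Z)
  end.

Definition post_value (Ct : R) (f : Z -> R) (y : state) : R :=
  pot1 f (fst y) + pot2 Ct f (snd y).

(** Two nonempty queues force a coded transmission at cost [Ct]. Otherwise waiting attains the
    minimum, since no packet is worth more than [Ct]. *)
Definition pre_value (Ct : R) (f : Z -> R) (y : state) : R :=
  match y with
  | (S i, S j) => Ct + post_value Ct f (i, j)
  | _ => post_value Ct f y
  end.

Definition next_value (p1 p2 : R) (F : state -> R) (y : state) (a : bool) : R :=
  fold_right (fun e acc => fst e * F (snd e) + acc) 0 (trans p1 p2 y a).

Lemma next_value_le (p1 p2 : R) (F F' : state -> R) (y : state) (a : bool) :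
  0 <= p1 <= 1 -> 0 <= p2 <= 1 ->
  (forall e, In e (trans p1 p2 y a) -> F (snd e) <= F' (snd e)) ->
  next_value p1 p2 F y a <= next_value p1 p2 F' y a.
Proof.
  intros Hp1 Hp2 H; unfold next_value.
  assert (Hpos : forall e, In e (trans p1 p2 y a) -> 0 <= fst e).
  { destruct y as [i j]; unfold trans; destruct a; simpl;
      intros e He; repeat destruct He as [He|He]; try contradiction;
      subst e; apply Rmult_le_pos; lra. }
  induction (trans p1 p2 y a) as [|e l IH]; simpl; [lra|].
  apply Rplus_le_compat.
  - apply Rmult_le_compat_l; [apply Hpos|apply H]; left; reflexivity.
  - apply IH; intros; [apply H|apply Hpos]; right; assumption.
Qed.

Lemma next_value_shift (p1 p2 k : R) (F : state -> R) (y : state) (a : bool) :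
  next_value p1 p2 (fun z => k + F z) y a = k + next_value p1 p2 F y a.
Proof. destruct y; unfold next_value, trans; destruct a; simpl; ring. Qed.

(** Transmission acts before the arrivals, so it amounts to waiting from the reduced state; only
    drifts under waiting need computing. *)
Lemma trans_transmit (p1 p2 : R) (i j : nat) :
  trans p1 p2 (i, j) true = trans p1 p2 (i - 1, j - 1)%nat false.
Proof.
  unfold trans.
  replace (Nat.max i 1) with (S (i - 1)) by lia.
  replace (Nat.max j 1) with (S (j - 1)) by lia; reflexivity.
Qed.

Lemma cost_transmit (Ch Ct : R) (i j : nat) :
  cost Ch Ct (i, j) true = Ct + cost Ch Ct (i - 1, j - 1)%nat false.
Proof.
  unfold cost; simpl fst; simpl snd; simpl act_nat; rewrite !Nat.sub_0_r.
  simpl INR; ring.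
Qed.

Definition one_sided (y : state) : Prop := fst y = O \/ snd y = O.

(** A lone arrival to [q1] either adds a packet of value [f (x + 1)] or pairs with one of [q2],
    changing the potential by [Ct - (Ct - f (x + 1))]. The two cases agree, and likewise for [q2]
    with [Ct - f x]; this is why [f] carries the offset [Ct] on the left. *)
Lemma post_value_drift (p1 p2 Ch Ct : R) (f : Z -> R) (i j : nat) :
  one_sided (i, j) ->
  cost Ch Ct (i, j) false + next_value p1 p2 (pre_value Ct f) (i, j) false
  = post_value Ct f (i, j)
    + drift p1 p2 Ch Ct f (Z.of_nat i - Z.of_nat j).
Proof.
  intros H.
  assert (Hcost : cost Ch Ct (i, j) false
                  = Ch * IZR (Z.abs (Z.of_nat i - Z.of_nat j))).
  { unfold cost; simpl fst; simpl snd; simpl act_nat; rewrite !Nat.sub_0_r.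
    rewrite INR_IZR_INZ; simpl INR; rewrite Rmult_0_r, Rplus_0_r.
    do 2 f_equal; destruct H as [H|H]; simpl in H; lia. }
  rewrite Hcost; unfold next_value, trans, drift, pre_value, post_value.
  destruct i as [|i], j as [|j].
  - simpl; ring.
  - replace (Z.of_nat 0 - Z.of_nat (S j) + 1)%Z with (- Z.of_nat j)%Z by lia.
    replace (Z.of_nat 0 - Z.of_nat (S j))%Z with (- Z.of_nat (S j))%Z by lia.
    cbn [fold_right fst snd pot1 pot2]; ring.
  - replace (Z.of_nat (S i) - Z.of_nat 0 + 1)%Z with (Z.of_nat (S i) + 1)%Z by lia.
    replace (Z.of_nat (S i) - Z.of_nat 0)%Z with (Z.of_nat i + 1)%Z by lia.
    cbn [fold_right fst snd pot1 pot2]; ring.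
  - destruct H as [H|H]; discriminate H.
Qed.

(** * Bellman inequality, and equality along the threshold policy *)

Definition reachable (y : state) : Prop := (fst y <= 1)%nat \/ (snd y <= 1)%nat.

Definition allowed (y : state) (a : bool) : Prop :=
  if a then (0 < fst y + snd y)%nat else one_sided y.

Lemma trans_reachable (p1 p2 : R) (y : state) (a : bool) (e : R * state) :
  reachable y -> allowed y a -> In e (trans p1 p2 y a) -> reachable (snd e).
Proof.
  destruct y as [i j], a; unfold reachable, allowed, one_sided; simpl;
    intros Hy Ha He; repeat destruct He as [He|He]; try contradiction;
    subst e; simpl; lia.
Qed.

(** Waiting costs at least [g] by the drift bound. An uncoded transmission pays [Ct] to remove a
    packet worth at most [Ct], and a coded one is already priced into [pre_value]. *)
Lemma bellman_ineq (p1 p2 Ch Ct : R) (f : Z -> R) (g : R) (L1 L2 : nat)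
    (y : state) (a : bool) :
  certificate p1 p2 Ch Ct f g L1 L2 -> reachable y -> allowed y a ->
  g + pre_value Ct f y
    <= cost Ch Ct y a + next_value p1 p2 (pre_value Ct f) y a.
Proof.
  intros [Hf _ _ HG _] Hy Ha; destruct y as [i j].
  unfold reachable in Hy; simpl in Hy; destruct a; simpl in Ha.
  - rewrite cost_transmit; unfold next_value at 1; rewrite trans_transmit.
    fold (next_value p1 p2 (pre_value Ct f) (i - 1, j - 1)%nat false).
    rewrite Rplus_assoc, post_value_drift by (unfold one_sided; simpl; lia).
    specialize (HG (Z.of_nat (i - 1) - Z.of_nat (j - 1))%Z).
    destruct i as [|i], j as [|j]; [lia| | |];
      unfold pre_value, post_value; simpl fst; simpl snd;
      rewrite ?Nat.sub_0_r in *; simpl pot1; simpl pot2.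
    + specialize (Hf (- Z.of_nat j)%Z); simpl Nat.sub in *; lra.
    + specialize (Hf (Z.of_nat i + 1)%Z); simpl Nat.sub in *; lra.
    + simpl Nat.sub in *; lra.
  - rewrite post_value_drift by exact Ha.
    specialize (HG (Z.of_nat i - Z.of_nat j)%Z).
    replace (pre_value Ct f (i, j)) with (post_value Ct f (i, j)); [lra|].
    destruct Ha as [Ha|Ha]; simpl in Ha; subst; [|destruct i]; reflexivity.
Qed.

(** An arrival may push a queue one packet past its threshold before the next decision, hence the
    successors. *)
Definition within (L1 L2 : nat) (y : state) : Prop :=
  reachable y /\ (fst y <= S L1)%nat /\ (snd y <= S L2)%nat.

Definition threshold_action (L1 L2 : nat) (y : state) : bool :=
  (Nat.ltb 0 (fst y * snd y) || Nat.ltb L1 (fst y) || Nat.ltb L2 (snd y))%bool.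

Lemma threshold_policy_action (L1 L2 : nat) (h : history) (y : state) :
  threshold_policy L1 L2 h y = if threshold_action L1 L2 y then 1 else 0.
Proof.
  destruct y as [i j]; unfold threshold_policy, threshold_action; simpl fst; simpl snd.
  destruct (Nat.ltb_spec 0 (i * j)); [reflexivity|].
  destruct (Nat.eqb_spec j 0) as [->|Hj].
  - rewrite Bool.orb_false_r; reflexivity.
  - assert (i = O) as -> by nia; reflexivity.
Qed.

Lemma threshold_policy_admissible (L1 L2 : nat) :
  admissible (threshold_policy L1 L2).
Proof.
  intros h y; rewrite threshold_policy_action; unfold threshold_action.
  destruct y as [i j]; simpl fst; simpl snd.
  destruct (Nat.ltb_spec 0 (i * j)), (Nat.ltb_spec L1 i), (Nat.ltb_spec L2 j);
    simpl; repeat split; intros; lra || lia || nia.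
Qed.

Lemma threshold_action_within (p1 p2 : R) (L1 L2 : nat) (y : state) (e : R * state) :
  within L1 L2 y -> In e (trans p1 p2 y (threshold_action L1 L2 y)) ->
  within L1 L2 (snd e).
Proof.
  destruct y as [i j]; unfold within, reachable, threshold_action; simpl fst; simpl snd.
  intros Hy He.
  destruct (Nat.ltb_spec 0 (i * j)), (Nat.ltb_spec L1 i), (Nat.ltb_spec L2 j);
    simpl in He; repeat destruct He as [He|He]; try contradiction;
    subst e; simpl fst; simpl snd; nia.
Qed.

(** Inside [within], uncoded transmissions occur only at [L1 + 1] or [L2 + 1] packets, where the
    packet removed is worth exactly [Ct]; every resulting post-decision state has drift [g]. *)
Lemma bellman_eq (p1 p2 Ch Ct : R) (f : Z -> R) (g : R) (L1 L2 : nat) (y : state) :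
  certificate p1 p2 Ch Ct f g L1 L2 -> within L1 L2 y ->
  cost Ch Ct y (threshold_action L1 L2 y)
    + next_value p1 p2 (pre_value Ct f) y (threshold_action L1 L2 y)
  = g + pre_value Ct f y.
Proof.
  intros [_ Hr Hl _ HG] [Hy [H1 H2]]; destruct y as [i j].
  unfold reachable in Hy; simpl in Hy, H1, H2.
  destruct (threshold_action L1 L2 (i, j)) eqn:Ha;
    unfold threshold_action in Ha; simpl fst in Ha; simpl snd in Ha.
  - rewrite cost_transmit; unfold next_value; rewrite trans_transmit.
    fold (next_value p1 p2 (pre_value Ct f) (i - 1, j - 1)%nat false).
    rewrite Rplus_assoc, post_value_drift by (unfold one_sided; simpl; lia).
    rewrite HG by lia.
    destruct i as [|i], j as [|j]; simpl Nat.sub;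
      rewrite ?Nat.sub_0_r; unfold pre_value, post_value; simpl fst; simpl snd;
      simpl pot1; simpl pot2.
    + simpl in Ha; discriminate Ha.
    + assert (j = L2) as ->.
      { destruct (Nat.ltb_spec L2 (S j)); [lia|discriminate Ha]. }
      rewrite Hl; ring.
    + assert (i = L1) as ->.
      { rewrite Nat.mul_0_r, Bool.orb_false_r in Ha.
        destruct (Nat.ltb_spec L1 (S i)); [lia|discriminate Ha]. }
      rewrite Hr; ring.
    + ring.
  - apply Bool.orb_false_iff in Ha; destruct Ha as [Ha Hj].
    apply Bool.orb_false_iff in Ha; destruct Ha as [Hij Hi].
    apply Nat.ltb_ge in Hij, Hi, Hj.
    assert (Ho : one_sided (i, j)) by (unfold one_sided; simpl; nia).
    rewrite post_value_drift by exact Ho.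
    rewrite HG by lia.
    replace (pre_value Ct f (i, j)) with (post_value Ct f (i, j)); [ring|].
    destruct Ho as [Ho|Ho]; simpl in Ho; subst; [|destruct i]; reflexivity.
Qed.

Lemma pre_value_nonneg (Ct : R) (f : Z -> R) (y : state) :
  (forall x, 0 <= f x <= Ct) -> 0 <= pre_value Ct f y.
Proof.
  intros Hf.
  assert (H1 : forall n, 0 <= pot1 f n).
  { induction n as [|n IH]; simpl; [lra|].
    specialize (Hf (Z.of_nat n + 1)%Z); lra. }
  assert (H2 : forall n, 0 <= pot2 Ct f n).
  { induction n as [|n IH]; simpl; [lra|].
    specialize (Hf (- Z.of_nat n)%Z); lra. }
  assert (H3 : forall z, 0 <= post_value Ct f z).
  { intros z; unfold post_value.
    specialize (H1 (fst z)); specialize (H2 (snd z)); lra. }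
  specialize (Hf 0%Z).
  destruct y as [[|i] [|j]]; unfold pre_value; try apply H3.
  specialize (H3 (i, j)); lra.
Qed.

Lemma pre_value_truncate_bounded (Ct : R) (K : nat) (f : Z -> R) (y : state) :
  (forall x, 0 <= truncate Ct K f x <= Ct) ->
  pre_value Ct (truncate Ct K f) y <= Ct + 2 * (Ct * INR (S K)).
Proof.
  intros Hf; set (t := truncate Ct K f) in *.
  assert (HCt : 0 <= Ct) by (specialize (Hf 0%Z); lra).
  assert (Hmin : forall n, Ct * INR (Nat.min n (S K)) <= Ct * INR (S K)).
  { intros n; apply Rmult_le_compat_l; [exact HCt|apply le_INR; lia]. }
  (* [Nat.min n (S K)] bounds the number of nonzero increments among the first [n]: truncation kills
     all those of index above [K]. *)
  assert (Hstep : forall n d, 0 <= d <= Ct -> ((K < n)%nat -> d = 0) ->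
            Ct * INR (Nat.min n (S K)) + d <= Ct * INR (Nat.min (S n) (S K))).
  { intros n d Hd Hd0; destruct (le_lt_dec n K) as [Hn|Hn].
    - replace (Nat.min n (S K)) with n by lia.
      replace (Nat.min (S n) (S K)) with (S n) by lia; rewrite S_INR; lra.
    - rewrite Hd0 by exact Hn.
      replace (Nat.min (S n) (S K)) with (Nat.min n (S K)) by lia; lra. }
  assert (H1 : forall n, pot1 t n <= Ct * INR (Nat.min n (S K))).
  { induction n as [|n IH]; [simpl; lra|].
    eapply Rle_trans; [|apply (Hstep n (t (Z.of_nat n + 1)%Z))].
    - simpl; lra.
    - apply Hf.
    - intros Hn; unfold t, truncate.
      destruct (Z.leb_spec (Z.of_nat n + 1) (Z.of_nat K)); [lia|reflexivity]. }
  assert (H2 : forall n, pot2 Ct t n <= Ct * INR (Nat.min n (S K))).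
  { induction n as [|n IH]; [simpl; lra|].
    eapply Rle_trans; [|apply (Hstep n (Ct - t (- Z.of_nat n)%Z))].
    - simpl; lra.
    - specialize (Hf (- Z.of_nat n)%Z); lra.
    - intros Hn; unfold t, truncate.
      destruct (Z.leb_spec (- Z.of_nat n) (Z.of_nat K)); [|lia].
      destruct (Z.leb_spec (- Z.of_nat K) (- Z.of_nat n)); [lia|ring]. }
  assert (H3 : forall z, post_value Ct t z <= 2 * (Ct * INR (S K))).
  { intros z; unfold post_value.
    specialize (H1 (fst z)); specialize (H2 (snd z)).
    assert (Ha := Hmin (fst z)); assert (Hb := Hmin (snd z)); lra. }
  assert (H4 := H3 y).
  destruct y as [[|i] [|j]]; unfold pre_value; try lra.
  specialize (H3 (i, j)); lra.
Qed.

(** * Finite-horizon bounds and the comparison of averages *)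

Lemma exp_cost_S (p1 p2 Ch Ct : R) (pol : policy) (N : nat) (h : history) (y : state) :
  exp_cost p1 p2 Ch Ct pol (S N) h y =
  pol h y * (cost Ch Ct y true
    + next_value p1 p2 (exp_cost p1 p2 Ch Ct pol N (h ++ (y, true) :: nil)) y true)
  + (1 - pol h y) * (cost Ch Ct y false
    + next_value p1 p2 (exp_cost p1 p2 Ch Ct pol N (h ++ (y, false) :: nil)) y false).
Proof. reflexivity. Qed.

(* At most one action may be forbidden, and the policy gives it weight [0]. *)
Lemma admissible_mix_le (pol : policy) (h : history) (y : state) (m u v : R) :
  admissible pol ->
  (allowed y true -> m <= u) -> (allowed y false -> m <= v) ->
  m <= pol h y * u + (1 - pol h y) * v.
Proof.
  intros Hpol Hu Hv; destruct (Hpol h y) as [Hq [H0 H1]].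
  destruct y as [i j]; unfold allowed, one_sided in *; simpl in *.
  destruct i as [|i], j as [|j].
  - rewrite H0 by reflexivity; specialize (Hv (or_introl eq_refl)); lra.
  - specialize (Hu ltac:(lia)); specialize (Hv ltac:(lia)); nra.
  - specialize (Hu ltac:(lia)); specialize (Hv ltac:(lia)); nra.
  - rewrite H1 by lia; specialize (Hu ltac:(lia)); lra.
Qed.

(** The Bellman inequality telescopes, leaving the expected terminal potential to subtract. An
    arbitrary policy may let the queues grow, so a uniform bound [B] on the potential is used. *)
Lemma exp_cost_lower (p1 p2 Ch Ct : R) (f : Z -> R) (g B : R) (L1 L2 : nat)
    (pol : policy) (N : nat) :
  0 <= p1 <= 1 -> 0 <= p2 <= 1 ->
  certificate p1 p2 Ch Ct f g L1 L2 -> (forall y, pre_value Ct f y <= B) ->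
  admissible pol ->
  forall h y, reachable y ->
    INR (S N) * g + pre_value Ct f y - B <= exp_cost p1 p2 Ch Ct pol N h y.
Proof.
  intros Hp1 Hp2 Hcert HB Hpol.
  induction N as [|N IH]; intros h y Hy.
  - assert (Hb : forall a, allowed y a -> g + pre_value Ct f y - B <= cost Ch Ct y a + 0).
    { intros a Ha; assert (H := bellman_ineq _ _ _ _ _ _ _ _ y a Hcert Hy Ha).
      assert (Hn : next_value p1 p2 (pre_value Ct f) y a <= B).
      { eapply Rle_trans.
        - apply (next_value_le p1 p2 _ (fun _ => B + 0)); auto.
          intros; rewrite Rplus_0_r; apply HB.
        - rewrite (next_value_shift p1 p2 B (fun _ => 0)).
          destruct y; unfold next_value, trans; destruct a; simpl; lra. }
      lra. }
    simpl INR; rewrite Rmult_1_l.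
    apply (admissible_mix_le pol h y _ _ _ Hpol); auto.
  - rewrite exp_cost_S.
    assert (Hb : forall a, allowed y a ->
      INR (S (S N)) * g + pre_value Ct f y - B <=
      cost Ch Ct y a +
      next_value p1 p2 (exp_cost p1 p2 Ch Ct pol N (h ++ (y, a) :: nil)) y a).
    { intros a Ha; assert (H := bellman_ineq _ _ _ _ _ _ _ _ y a Hcert Hy Ha).
      assert (Hn := next_value_le p1 p2
                (fun z => (INR (S N) * g - B) + pre_value Ct f z)
                (exp_cost p1 p2 Ch Ct pol N (h ++ (y, a) :: nil)) y a Hp1 Hp2).
      rewrite next_value_shift in Hn.
      assert (Hn' := Hn (fun e He => ltac:(
        specialize (IH (h ++ (y, a) :: nil) (snd e)
          (trans_reachable _ _ _ _ _ Hy Ha He)); lra))).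
      rewrite (S_INR (S N)); lra. }
    apply (admissible_mix_le pol h y _ _ _ Hpol); auto.
Qed.

(** The Bellman equality telescopes because [within] is preserved; the terminal potential is
    nonnegative and is dropped. *)
Lemma exp_cost_threshold (p1 p2 Ch Ct : R) (f : Z -> R) (g : R) (L1 L2 : nat) (N : nat) :
  0 <= p1 <= 1 -> 0 <= p2 <= 1 ->
  certificate p1 p2 Ch Ct f g L1 L2 ->
  forall h y, within L1 L2 y ->
    exp_cost p1 p2 Ch Ct (threshold_policy L1 L2) N h y
      <= INR (S N) * g + pre_value Ct f y.
Proof.
  intros Hp1 Hp2 Hcert.
  assert (Hmix : forall h y (F : bool -> R),
    threshold_policy L1 L2 h y * F true + (1 - threshold_policy L1 L2 h y) * F false
    = F (threshold_action L1 L2 y)).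
  { intros h y F; rewrite threshold_policy_action.
    destruct (threshold_action L1 L2 y); ring. }
  induction N as [|N IH]; intros h y Hy;
    assert (H := bellman_eq _ _ _ _ _ _ _ _ y Hcert Hy).
  - simpl exp_cost; rewrite (Hmix h y (fun a => cost Ch Ct y a + 0)).
    assert (Hn := next_value_le p1 p2 (fun _ => 0) (pre_value Ct f) y
              (threshold_action L1 L2 y) Hp1 Hp2
              (fun e _ => pre_value_nonneg Ct f (snd e) (cert_bounds _ _ _ _ _ _ _ _ Hcert))).
    assert (Hz : next_value p1 p2 (fun _ => 0) y (threshold_action L1 L2 y) = 0).
    { destruct y; unfold next_value, trans; destruct threshold_action; simpl; ring. }
    simpl INR; lra.
  - rewrite exp_cost_S.
    rewrite (Hmix h y (fun a => cost Ch Ct y a +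
      next_value p1 p2 (exp_cost p1 p2 Ch Ct (threshold_policy L1 L2) N
                          (h ++ (y, a) :: nil)) y a)).
    set (a := threshold_action L1 L2 y) in *.
    assert (Hn := next_value_le p1 p2
      (exp_cost p1 p2 Ch Ct (threshold_policy L1 L2) N (h ++ (y, a) :: nil))
      (fun z => INR (S N) * g + pre_value Ct f z) y a Hp1 Hp2
      (fun e He => IH _ _ (threshold_action_within _ _ _ _ _ _ Hy He))).
    rewrite next_value_shift in Hn.
    rewrite (S_INR (S N)); lra.
Qed.

Theorem theorem3 (p1 p2 Ct Ch : R) :
  0 < p1 < 1 -> 0 < p2 < 1 -> 0 < Ct -> 0 < Ch ->
  exists L1 L2 : nat,
    admissible (threshold_policy L1 L2) /\
    forall pol : policy, admissible pol ->
      Rbar_le (avg_cost p1 p2 Ch Ct (threshold_policy L1 L2))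
              (avg_cost p1 p2 Ch Ct pol).
Proof.
  intros Hp1 Hp2 HCt HCh.
  destruct (certificate_exists p1 p2 Ch Ct) as [f0 [g [L1 [L2 Hcert0]]]]; auto.
  destruct (certificate_truncate _ _ _ _ _ _ _ _ Hp1 Hp2 HCt HCh Hcert0) as [K Hcert].
  assert (HB := fun y => pre_value_truncate_bounded Ct K f0 y
                           (cert_bounds _ _ _ _ _ _ _ _ Hcert)).
  set (f := truncate Ct K f0) in *; set (B := Ct + 2 * (Ct * INR (S K))) in HB.
  assert (Hr0 : reachable (0, 0)%nat) by (left; simpl; lia).
  assert (Hv0 : pre_value Ct f (0, 0)%nat = 0)
    by (unfold pre_value, post_value; simpl; ring).
  exists L1, L2; split; [apply threshold_policy_admissible|].
  intros pol Hpol; unfold avg_cost.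
  assert (HS : forall N, 0 < INR (S N)) by (intros; apply lt_0_INR; lia).
  (* The threshold policy averages at most [g], and every admissible policy at least [g]; the
     potential vanishes at the initial state. *)
  apply Rbar_le_trans with g.
  - rewrite <- (LimSup_seq_const g); apply LimSup_le; exists O; intros N _.
    apply Rle_div_l; [apply HS|].
    assert (H := exp_cost_threshold p1 p2 Ch Ct f g L1 L2 N ltac:(lra) ltac:(lra)
                   Hcert nil (0, 0)%nat).
    rewrite Hv0 in H; rewrite Rmult_comm, <- (Rplus_0_r (INR (S N) * g)).
    apply H; repeat split; [exact Hr0| |]; simpl; lia.
  (* Dividing the lower bound by [N + 1] leaves [g - B / (N + 1)], whose upper limit is its limit
     [g]. *)
  - assert (Hlim : is_lim_seq (fun N => g - B / INR (S N)) g).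
    { replace (Finite g) with (Finite (g - B * 0)) by (f_equal; ring).
      apply is_lim_seq_minus'; [apply is_lim_seq_const|].
      apply (is_lim_seq_scal_l _ B (Finite 0)).
      apply -> (is_lim_seq_incr_1 (fun n => / INR n)).
      apply (is_lim_seq_inv INR p_infty is_lim_seq_INR); discriminate. }
    rewrite <- (is_LimSup_seq_unique _ _ (is_lim_LimSup_seq _ _ Hlim)).
    apply LimSup_le; exists O; intros N _.
    assert (H := exp_cost_lower p1 p2 Ch Ct f g B L1 L2 pol N ltac:(lra) ltac:(lra)
                   Hcert HB Hpol nil (0, 0)%nat Hr0).
    rewrite Hv0 in H; apply Rle_div_r; [apply HS|].
    replace ((g - B / INR (S N)) * INR (S N)) with (INR (S N) * g + 0 - B);
      [exact H|].
    field; specialize (HS N); lra.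
Qed.
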